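(* For any family of Boolean functions $F = \{f_n\}_{n \in \mathbb{N}}$ and any $\Delta\colon \mathbb{N} \to \mathbb{N}$, $\mathcal{L}^{\mathrm{LNBF}_{\Delta(n)}}_F(n) \in O\bigl(\max\bigl\{\frac{n^2}{2^{\Delta(n)} \log_2 n}, n\bigr\}\bigr)$. In particular, $\mathcal{L}^{\mathrm{BF}}_F(n) \in O\bigl(\frac{n^2}{\log_2 n}\bigr)$.
   Context: For an $n$-ary Boolean function $f$ and $V \subseteq [n]$, $r_V(f)$ denotes the number of distinct subfunctions of $f$ on $V$ obtained by fixing the variables outside $V$. A Nečiporuk function for a complexity measure $\mathbf{M}$ is a non-decreasing $b\colon \mathbb{N}_{>0}\to\mathbb{N}$ such that for every $n$, every $n$-ary $f$ and every partition $V_1,\dots,V_p$ of $[n]$, $\mathbf{M}(f) \ge \sum_{i=1}^p b(r_{V_i}(f))$; $\mathcal{N}_{\mathbf{M}}$ is the set of these, and $\mathcal{L}^{\mathbf{M}}_F(n) = \max\{\sum_{i=1}^p b(r_{V_i}(f_n)) \mid b \in \mathcal{N}_{\mathbf{M}},\ V_1,\dots,V_p \text{ partition of } [n]\}$. A Boolean binary formula is a binary tree whose internal nodes are labelled by arbitrary functions $\{0,1\}^2\to\{0,1\}$ and whose leaves are labelled by $0,1$ or literals $x_i,\neg x_i$; its size is the number of non-constant leaves, and $\mathrm{BF}(f)$ is the minimum size of a formula computing $f$. A $\delta$-limited nondeterministic binary formula for $f$ is a formula $\varphi'$ on $n+\delta$ variables with $f(a) = \bigvee_{b\in\{0,1\}^\delta}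 f_{\varphi'}(a,b)$; $\mathrm{LNBF}_\delta(f)$ is the minimum size of such a formula. *)

(* Defs.v *)
From mathcomp Require Import all_boot all_order all_algebra.
From mathcomp Require Import boolp reals exp.
Set Implicit Arguments.
Unset Strict Implicit.
Unset Printing Implicit Defensive.

Import GRing.Theory.

Definition assignment (n : nat) := {ffun 'I_n -> bool}.
Definition boolfun (n : nat) := {ffun assignment n -> bool}.

Section Subfunctions.
Variables (n : nat) (V : {set 'I_n}).

Definition assignment_on := {ffun {i : 'I_n | i \in V} -> bool}.

(* Only the values of [a] outside [V] matter. *)
Definition override (a : assignment n) (y : assignment_on) : assignment n :=
  [ffun i => if insub i is Some u then y u else a i].

Definition subfunction (f : boolfun n) (a : assignment n) :
    {ffun assignment_on -> bool} :=
  [ffun y => f (override a y)].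

Definition nb_subfunctions (f : boolfun n) : nat :=
  #|[set subfunction f a | a : assignment n]|.

End Subfunctions.

Definition complexity_measure := forall n : nat, boolfun n -> nat.

Definition neciporuk_sum (b : nat -> nat) (n : nat) (f : boolfun n)
    (P : {set {set 'I_n}}) : nat :=
  \sum_(V in P) b (nb_subfunctions V f).

(* Functions on positive integers are represented by [nat -> nat]; the value
   at 0 is unconstrained and never used, since [nb_subfunctions] is positive.
   The blocks of a [finset.partition] are nonempty. *)
Definition is_neciporuk (M : complexity_measure) (b : nat -> nat) : Prop :=
  (forall k l : nat, 0 < k -> k <= l -> b k <= b l) /\
  (forall (n : nat) (f : boolfun n) (P : {set {set 'I_n}}),
     finset.partition P [set: 'I_n] -> neciporuk_sum b f P <= M n f).

Section BestBound.
Variables (M : complexity_measure) (F : forall n : nat, boolfun n) (n : nat).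

Definition neciporuk_bound (v : nat) : bool :=
  `[< exists (b : nat -> nat) (P : {set {set 'I_n}}),
        [/\ is_neciporuk M b, finset.partition P [set: 'I_n]
          & neciporuk_sum b (F n) P = v] >].

Lemma neciporuk_bound_exists : exists v, neciporuk_bound v.
Proof.
exists 0; apply/asboolP.
exists (fun=> 0), (equivalence_partition (fun x y => x == y) [set: 'I_n]).
split.
- by split=> // k f P _; rewrite /neciporuk_sum big1.
- apply: equivalence_partitionP => x y z _ _ _; split=> //.
  by move/eqP->.
- by rewrite /neciporuk_sum big1.
Qed.

Lemma neciporuk_bound_le v : neciporuk_bound v -> v <= M (F n).
Proof. by move=> /asboolP[b [P [[_ Mb] partP <-]]]; apply: Mb. Qed.

Definition best_neciporuk : nat :=
  ex_maxn neciporuk_bound_exists neciporuk_bound_le.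

End BestBound.

Inductive formula (n : nat) : Type :=
| Const of bool
| Lit of bool & 'I_n  (* [Lit false i] is x_i and [Lit true i] its negation *)
| Gate of (bool -> bool -> bool) & formula n & formula n.

Arguments Const {n}.

Fixpoint eval n (phi : formula n) (a : assignment n) : bool :=
  match phi with
  | Const c => c
  | Lit s i => s (+) a i
  | Gate g phi1 phi2 => g (eval phi1 a) (eval phi2 a)
  end.

Fixpoint formula_size n (phi : formula n) : nat :=
  match phi with
  | Const _ => 0
  | Lit _ _ => 1
  | Gate _ phi1 phi2 => formula_size phi1 + formula_size phi2
  end.

Definition computes n (phi : formula n) (f : boolfun n) : Prop :=
  forall a, f a = eval phi a.

Definition join_assignment n d (a : assignment n) (b : assignment d) :
    assignment (n + d) :=
  [ffun i => match split i with inl j => a j | inr k => b k end].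

Definition computes_nondet n d (phi : formula (n + d)) (f : boolfun n) : Prop :=
  forall a, f a = [exists b : assignment d, eval phi (join_assignment a b)].

Lemma formula_exists n (f : boolfun n) : exists phi, computes phi f.
Proof.
pose lits (a : assignment n) (s : seq 'I_n) : formula n :=
  foldr (fun i phi => Gate andb (Lit (~~ a i) i) phi) (Const true) s.
have litsE a s x : eval (lits a s) x = all (fun i => x i == a i) s.
  elim: s => //= i s ->; congr (_ && _).
  by case: (x i) (a i) => [] [].
pose dnf s : formula n :=
  foldr (fun a phi => Gate orb (lits a (enum 'I_n)) phi) (Const false) s.
have dnfE s x : eval (dnf s) x = (x \in s).
  elim: s => //= a s ->; rewrite litsE inE; congr (_ || _).
  apply/allP/eqP => [xa | -> //]; apply/ffunP => i.
  by apply/eqP/xa; rewrite mem_enum.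
exists (dnf (enum [pred x | f x])) => x.
by rewrite dnfE mem_enum inE.
Qed.

Lemma nondet_formula_exists n d (f : boolfun n) :
  exists phi : formula (n + d), computes_nondet phi f.
Proof.
pose g : boolfun (n + d) :=
  [ffun c : assignment (n + d) => f [ffun i => c (lshift d i)]].
have [phi phiP] := formula_exists g; exists phi => a.
have eval_phi b : eval phi (join_assignment a b) = f a.
  rewrite -phiP ffunE; congr (f _); apply/ffunP => i.
  by rewrite !ffunE (unsplitK (inl i : 'I_n + 'I_d)).
apply/idP/existsP => [fa | [b]]; last by rewrite eval_phi.
by exists [ffun=> false]; rewrite eval_phi.
Qed.

Definition has_formula_of_size n (f : boolfun n) (k : nat) : bool :=
  `[< exists phi : formula n, computes phi f /\ formula_size phi = k >].

Lemma has_formula_of_size_exists n (f : boolfun n) :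
  exists k, has_formula_of_size f k.
Proof.
by have [phi phif] := formula_exists f; exists (formula_size phi);
   apply/asboolP; exists phi.
Qed.

Definition BF : complexity_measure :=
  fun n f => ex_minn (has_formula_of_size_exists f).

Definition has_nondet_formula_of_size d n (f : boolfun n) (k : nat) : bool :=
  `[< exists phi : formula (n + d),
        computes_nondet phi f /\ formula_size phi = k >].

Lemma has_nondet_formula_of_size_exists d n (f : boolfun n) :
  exists k, has_nondet_formula_of_size d f k.
Proof.
by have [phi phif] := nondet_formula_exists d f; exists (formula_size phi);
   apply/asboolP; exists phi.
Qed.

Definition LNBF (d : nat) : complexity_measure :=
  fun n f => ex_minn (has_nondet_formula_of_size_exists d f).

Definition log2 {R : realType} (x : R) : R := (ln x / ln 2)%R.

(* Main.v *)
(* A Neciporuk function b for LNBF_D is bounded on large arguments by testing it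
   on one function with many address blocks: f(y_1, ..., y_q, x) = x_(y_1 + ... + y_q)
   (bitwise xor) with addresses of k + d bits, d <= D and q = 2^d. Each block
   has all 2^2^(k+d) data tables x as subfunctions. A nondeterministic formula
   guesses the last d bits of the address, checks the guess, and looks up x in
   a binary decision tree whose d lower levels test only guessed bits, so that
   only 2^k copies of each y_j are needed. Its size is O(2^d (2^k + d)), and
   dividing by the number of blocks gives b(2^2^(k+d)) = O(2^k + d).
   In a partition of [n], a block V has at most 2^2^t subfunctions with
   t = min(|V|, l), l being log_2 n rounded up; taking d = min(D, t) and
   k = t - d, and since l 2^t <= |V| 2^l, the bounds on b add up to
   O(n^2 / (2^D log n) + n). *)
Require Import Defs.
From mathcomp Require Import all_boot all_order all_algebra.
From mathcomp Require Import boolp classical_sets reals topology normedtype landau exp.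
From mathcomp Require Import zify ring.
Set Implicit Arguments.
Unset Strict Implicit.
Unset Printing Implicit Defensive.

(* [topology] exports another [eval]. *)
Local Notation eval := Defs.eval.

(** * Formulas: minimal sizes, renaming of variables, iterated gates *)

Lemma LNBF_le d n (f : boolfun n) (phi : formula (n + d)) :
  computes_nondet phi f -> LNBF d f <= formula_size phi.
Proof.
move=> phif; rewrite /LNBF; case: ex_minnP => m _; apply.
by apply/asboolP; exists phi.
Qed.

Fixpoint rename m n (s : 'I_m -> 'I_n) (phi : formula m) : formula n :=
  match phi with
  | Const c => Const c
  | Lit e i => Lit e (s i)
  | Gate g phi1 phi2 => Gate g (rename s phi1) (rename s phi2)
  end.

Lemma eval_rename m n (s : 'I_m -> 'I_n) phi (a : assignment n) :
  eval (rename s phi) a = eval phi [ffun i => a (s i)].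
Proof. by elim: phi => [||g phi1 IH1 phi2 IH2] //= *; rewrite ?ffunE ?IH1 ?IH2. Qed.

Lemma size_rename m n (s : 'I_m -> 'I_n) phi :
  formula_size (rename s phi) = formula_size phi.
Proof. by elim: phi => //= g phi1 -> phi2 ->. Qed.

(** With no guessed bit the disjunction runs over the single empty guess. The renaming is there
    because [n + 0] is not convertible to [n]. *)
Lemma BF_le_LNBF0 n (f : boolfun n) : BF f <= LNBF 0 f.
Proof.
rewrite /LNBF; case: ex_minnP => m /asboolP[phi [phif <-]] _.
rewrite /BF; case: ex_minnP => p _; apply; apply/asboolP.
exists (rename (cast_ord (addn0 n)) phi); split; last exact: size_rename.
have join0 a (b : assignment 0) :
    join_assignment a b = [ffun i => a (cast_ord (addn0 n) i)].
  apply/ffunP => i; rewrite !ffunE; case: splitP => [j ij | []] //.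
  by congr (a _); apply: val_inj.
move=> a; rewrite phif eval_rename; apply/existsP/idP => [[b]|].
  by rewrite join0.
by exists [ffun=> false]; rewrite join0.
Qed.

Lemma eval_big n I (r : seq I) (P : pred I) op c (phi : I -> formula n) a :
  eval (\big[Gate op/Const c]_(i <- r | P i) phi i) a =
  \big[op/c]_(i <- r | P i) eval (phi i) a.
Proof. exact: (big_morph (fun psi => eval psi a)). Qed.

Lemma size_big n I (r : seq I) (P : pred I) op c (phi : I -> formula n) :
  formula_size (\big[Gate op/Const c]_(i <- r | P i) phi i) =
  \sum_(i <- r | P i) formula_size (phi i).
Proof. exact: (big_morph (@formula_size n)). Qed.

(** A complete decision tree with the head of [s] tested at the root. Formulas cannot share
    subterms, so every node holds two copies of its test. *)
Fixpoint mux n (s : seq (formula n)) (D : seq bool -> formula n) : formula n :=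
  if s is phi :: s' then
    Gate orb (Gate andb phi (mux s' (fun w => D (true :: w))))
      (Gate (fun x y => ~~ x && y) phi (mux s' (fun w => D (false :: w))))
  else D [::].

Lemma eval_mux n (s : seq (formula n)) D a :
  eval (mux s D) a = eval (D [seq eval phi a | phi <- s]) a.
Proof.
elim: s D => //= phi s IH D; rewrite !IH.
by case: (eval phi a); rewrite /= ?orbF.
Qed.

(* [List.In] because [formula n] is not an eqType. *)
Lemma size_mux n (s : seq (formula n)) D c l :
    (forall phi, List.In phi s -> formula_size phi <= c) ->
    (forall w, formula_size (D w) <= l) ->
  formula_size (mux s D) <= 2 ^ size s * (l + 2 * c).
Proof.
(* The added [2 * c] lets the induction close: the two copies of the test and this slack give one
   [2 * c] to each subtree. *)
move=> sc Dl; suff: formula_size (mux s D) + 2 * c <= 2 ^ size s * (l + 2 * c).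
  exact/leq_trans/leq_addr.
elim: s D sc Dl => [|phi s IH] D sc Dl /=; first by rewrite mul1n leq_add2r.
have phic := sc phi (or_introl erefl).
have sc' psi : List.In psi s -> formula_size psi <= c.
  by move=> ?; apply: sc; right.
have IHt := IH _ sc' (fun w => Dl (true :: w)).
have IHf := IH _ sc' (fun w => Dl (false :: w)).
by rewrite expnS -[2 * _ * _]mulnA; lia.
Qed.

(** * The test function: access to a table at a xor of addresses *)

Section XorAccess.
Variables k d q : nat.

Let addr_bit := ('I_k + 'I_d)%type.
(** Variables keep their structure and are numbered by [enum_rank], which avoids index
    arithmetic. *)
Let var := ('I_q * addr_bit + {ffun addr_bit -> bool})%type.
Local Notation N := #|{: var}|.

Definition bit_var (j : 'I_q) (b : addr_bit) : 'I_N :=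
  enum_rank (inl (j, b) : var).
Definition data_var (h : {ffun addr_bit -> bool}) : 'I_N :=
  enum_rank (inr h : var).

Definition address (a : assignment N) : {ffun addr_bit -> bool} :=
  [ffun b => \big[addb/false]_(j < q) a (bit_var j b)].

Definition xor_access : boolfun N :=
  [ffun a : assignment N => a (data_var (address a))].

Definition block_index (i : 'I_N) : option 'I_q :=
  if (enum_val i : var) is inl (j, _) then Some j else None.

Definition address_block (j : 'I_q) : {set 'I_N} :=
  [set i | block_index i == Some j].

Definition block_partition : {set {set 'I_N}} :=
  preim_partition block_index [set: 'I_N].

Lemma block_index_bit j b : block_index (bit_var j b) = Some j.
Proof. by rewrite /block_index /bit_var enum_rankK. Qed.

Lemma block_index_data h : block_index (data_var h) = None.
Proof. by rewrite /block_index /data_var enum_rankK. Qed.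

(** Without address bits the address blocks would be empty, and a partition has no empty block. *)
Lemma address_block_mem j : 0 < k + d -> address_block j \in block_partition.
Proof.
move=> kd_gt0; have /card_gt0P[b _] : 0 < #|{: addr_bit}|.
  by rewrite card_sum !card_ord.
apply/imsetP; exists (bit_var j b); first by rewrite inE.
by apply/setP => i; rewrite !inE block_index_bit eq_sym.
Qed.

Lemma address_block_inj : 0 < k + d -> injective address_block.
Proof.
move=> kd_gt0 j j'; have /card_gt0P[b _] : 0 < #|{: addr_bit}|.
  by rewrite card_sum !card_ord.
move/setP/(_ (bit_var j b)); rewrite !inE block_index_bit eqxx.
by move/esym/eqP => [].
Qed.

(** Fix the data to a table [g] and all other address blocks to zero: the block [j] then holds the
    whole address, and the subfunction is [g] itself. *)
Lemma nb_subfunctions_xor_access j :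
  2 ^ 2 ^ (k + d) <= nb_subfunctions (address_block j) xor_access.
Proof.
pose data (g : {ffun {ffun addr_bit -> bool} -> bool}) : assignment N :=
  [ffun i => if (enum_val i : var) is inr h then g h else false].
pose sub g := subfunction (address_block j) xor_access (data g).
have <- : #|[set sub g | g : {ffun {ffun addr_bit -> bool} -> bool}]| = 2 ^ 2 ^ (k + d).
  rewrite card_imset; first by rewrite !card_ffun !card_bool card_sum !card_ord.
  move=> g g' /ffunP eq_sub; apply/ffunP => h.
  pose y : assignment_on (address_block j) :=
    [ffun u => if (enum_val (val u) : var) is inl (_, b) then h b else false].
  have overrideE a : override (data a) y (data_var h) = a h.
    rewrite ffunE insubF; last by rewrite inE block_index_data.
    by rewrite ffunE /data_var enum_rankK.
  have addressE a : address (override (data a) y) = h.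
    apply/ffunP => b; rewrite ffunE (bigD1 j) //= big1 => [|j' j'j]; last first.
      rewrite ffunE insubF; last first.
        by rewrite inE block_index_bit; apply/eqP => -[] /eqP; apply/negP.
      by rewrite ffunE /bit_var enum_rankK.
    rewrite addbF ffunE.
    have jb : bit_var j b \in address_block j by rewrite inE block_index_bit.
    by rewrite (insubT (fun i => i \in address_block j) jb) ffunE /= enum_rankK.
  have sub_y a : sub a y = a h by rewrite ffunE [LHS]ffunE addressE overrideE.
  by rewrite -!sub_y.
by apply/subset_leq_card/fintype.subsetP => _ /imsetP[g _ ->]; apply: imset_f.
Qed.

Section Guessing.
Variables (D : nat) (dD : d <= D).

Let bit_formula (b : addr_bit) : formula (N + D) :=
  \big[Gate addb/Const false]_(j < q) Lit false (lshift D (bit_var j b)).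

Let guess_formula (i : 'I_d) : formula (N + D) :=
  Lit false (rshift N (widen_ord dD i)).

Let guessed_address (w1 w2 : seq bool) : {ffun addr_bit -> bool} :=
  [ffun b : addr_bit => match b with
             | inl i => nth false w1 i
             | inr i => nth false w2 i
             end].

Let lookup_formula : formula (N + D) :=
  mux [seq bit_formula (inl i) | i <- enum 'I_k] (fun w1 =>
    mux [seq guess_formula i | i <- enum 'I_d] (fun w2 =>
      Lit false (lshift D (data_var (guessed_address w1 w2))))).

Let check_formula : formula (N + D) :=
  \big[Gate andb/Const true]_(i < d)
    Gate (fun x y => x == y) (bit_formula (inr i)) (guess_formula i).

(** The check costs [q + 1] for each guessed bit. In the lookup, the lower tree has [2 ^ d] leaves,
    each counted with weight 1 + 2; the upper tree has [2 ^ k] such leaves and tests of size [q]. *)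
Lemma xor_access_formula : exists phi : formula (N + D),
  computes_nondet phi xor_access /\
  formula_size phi <= d * q.+1 + 2 ^ k * (3 * 2 ^ d + 2 * q).
Proof.
exists (Gate andb check_formula lookup_formula); split=> [a|]; last first.
  have size_bit b : formula_size (bit_formula b) = q.
    by rewrite size_big sum1_card card_ord.
  rewrite /= leq_add //.
    rewrite size_big /= (eq_bigr (fun=> q.+1)) ?sum_nat_const ?card_ord //.
    by move=> i _; rewrite size_bit addn1.
  apply: leq_trans (size_mux (c := q) (l := 3 * 2 ^ d) _ _) _.
  - by move=> phi /List.in_map_iff[i [<- _]]; rewrite size_bit.
  - move=> w1; apply: leq_trans (size_mux (c := 1) (l := 1) _ _) _ => //.
      by move=> phi /List.in_map_iff[i [<- _]].
    by rewrite size_map size_enum_ord mulnC.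
  - by rewrite size_map size_enum_ord.
have joinl (g : assignment D) i : join_assignment a g (lshift D i) = a i.
  by rewrite ffunE (unsplitK (inl i : 'I_N + 'I_D)).
have joinr (g : assignment D) i : join_assignment a g (rshift N i) = g i.
  by rewrite ffunE (unsplitK (inr i : 'I_N + 'I_D)).
have evalb g b : eval (bit_formula b) (join_assignment a g) = address a b.
  by rewrite eval_big ffunE; apply: eq_bigr => j _; rewrite /= joinl.
pose guess_ok (g : assignment D) :=
  [forall i : 'I_d, address a (inr i) == g (widen_ord dD i)].
have evalE g : eval (Gate andb check_formula lookup_formula) (join_assignment a g)
    = guess_ok g && xor_access a.
  rewrite /= eval_big /= big_andE /guess_ok.
  under eq_forallb => i do rewrite evalb joinr.
  apply: andb_id2l => /forallP gP.
  rewrite !eval_mux /= joinl ffunE; congr (a (data_var _)).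
  apply/ffunP => b; rewrite ffunE.
  case: b => i; rewrite -map_comp (nth_map i) ?size_enum_ord //= nth_ord_enum.
    exact: evalb.
  by rewrite joinr; apply/esym/eqP/gP.
apply/idP/existsP => [fa | [g]]; last by rewrite evalE => /andP[].
(* Guess the true last [d] address bits and set the other [D - d] guessed bits to false. *)
exists [ffun i => if insub (val i) is Some i' then address a (inr i') else false].
rewrite evalE fa andbT; apply/forallP => i.
by rewrite [eqbRHS]ffunE (valK i : insub (val (widen_ord dD i)) = Some i).
Qed.

End Guessing.

End XorAccess.

(** * Bounds on Neciporuk functions, blocks and sums *)

(** For [q = 2 ^ d] the formula has size at most [2 ^ d * (5 * 2 ^ k + d) + d], which pays for the
    [2 ^ d] address blocks; the contribution of the data variables is dropped. *)
Lemma neciporuk_le D b k d : is_neciporuk (LNBF D) b -> d <= D -> 0 < k + d ->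
  b (2 ^ 2 ^ (k + d)) <= 5 * 2 ^ k + 2 * d.
Proof.
move=> [b_mono bP] dD kd_gt0; have q_gt0 : 0 < 2 ^ d by rewrite expn_gt0.
have [phi [phif size_phi]] := xor_access_formula k (2 ^ d) dD.
rewrite -(leq_pmul2l q_gt0).
have := bP _ (xor_access k d (2 ^ d)) (block_partition k d (2 ^ d))
  (preim_partitionP _ _).
move=> /leq_trans/(_ (LNBF_le phif))/leq_trans/(_ size_phi) sum_le.
apply: leq_trans (leq_trans sum_le _).
  rewrite /neciporuk_sum (big_setID [set @address_block k d (2 ^ d) j | j : 'I_(2 ^ d)]) /=.
  rewrite (finset.setIidPr _); last first.
    by apply/fintype.subsetP => _ /imsetP[j _ ->]; apply: address_block_mem.
  apply: leq_trans (leq_addr _ _).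
  rewrite big_imset /=; last by move=> ? ? _ _; apply: address_block_inj.
  rewrite -[X in X * _ <= _]card_ord -sum_nat_const leq_sum // => j _.
  apply: b_mono; first by rewrite expn_gt0.
  exact: nb_subfunctions_xor_access.
have : d <= d * 2 ^ d by rewrite leq_pmulr.
lia.
Qed.

Lemma nb_subfunctions_gt0 n (V : {set 'I_n}) (f : boolfun n) :
  0 < nb_subfunctions V f.
Proof.
apply/card_gt0P; exists (subfunction V f [ffun=> false]); exact: imset_f.
Qed.

Lemma nb_subfunctions_le_exp n (V : {set 'I_n}) (f : boolfun n) :
  nb_subfunctions V f <= 2 ^ n.
Proof.
apply: leq_trans (leq_imset_card _ _) _.
by rewrite card_ffun card_bool card_ord.
Qed.

Lemma nb_subfunctions_le_exp_exp n (V : {set 'I_n}) (f : boolfun n) :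
  nb_subfunctions V f <= 2 ^ 2 ^ #|V|.
Proof.
by apply: leq_trans (max_card _) _; rewrite !card_ffun !card_bool card_sig.
Qed.

(* The case v <= l of the proof is v + j <= v 2^j for j = l - v. *)
Lemma minn_exp_le v l : 0 < v -> l * 2 ^ minn v l <= v * 2 ^ l.
Proof.
move=> v_gt0; case: (leqP l v) => [lv | /ltnW vl]; first by rewrite leq_mul2r lv orbT.
rewrite -[in X in X * _ <= _](subnKC vl) -[in X in _ <= X](subnKC vl).
rewrite expnD mulnCA mulnC leq_mul2l; apply/orP; right.
have := ltn_expl (l - v) (isT : 1 < 2); move: (l - v) (2 ^ _) => j p; nia.
Qed.

Lemma neciporuk_block_le D b n (f : boolfun n) (V : {set 'I_n}) l :
    is_neciporuk (LNBF D) b -> 0 < #|V| -> 0 < l -> n <= 2 ^ l ->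
  2 ^ D * l * b (nb_subfunctions V f) <=
    #|V| * (5 * 2 ^ l + 9 * (2 ^ D * l)).
Proof.
(* The subfunctions number at most [2 ^ 2 ^ #|V|], and at most [2 ^ n <= 2 ^ 2 ^ l], whence the
   minimum [t]. *)
move=> bN V_gt0 l_gt0 n_le; pose t := minn #|V| l; pose d := minn D t.
have t_gt0 : 0 < t by rewrite leq_min V_gt0.
have dt : d <= t := geq_minr _ _.
have := neciporuk_le bN (geq_minl D t : d <= D) (_ : 0 < t - d + d).
rewrite subnK // => /(_ t_gt0) bt.
have r_le : nb_subfunctions V f <= 2 ^ 2 ^ t.
  rewrite /t /minn; case: ifP => _; first exact: nb_subfunctions_le_exp_exp.
  by apply: leq_trans (nb_subfunctions_le_exp _ _) _; rewrite leq_exp2l.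
have {bt r_le} b_le := leq_trans (bN.1 _ _ (nb_subfunctions_gt0 _ _) r_le) bt.
(* If [D <= t] then [d = D] and the product is [2 ^ t]; otherwise [d = t] and it is [2 ^ D]. *)
have pow_le : 2 ^ D * 2 ^ (t - d) <= 2 ^ t + 2 ^ D.
  rewrite /d; case: (leqP D t) => Dt; first by rewrite -expnD subnKC ?leq_addr.
  by rewrite subnn muln1 leq_addl.
have tV : t <= #|V| := geq_minl _ _.
have lt_le : l * 2 ^ t <= #|V| * 2 ^ l := minn_exp_le l V_gt0.
apply: leq_trans (leq_mul (leqnn _) b_le) _.
have dV := leq_trans dt tV; move: b_le dt dV pow_le lt_le.
move: (2 ^ D) (2 ^ (t - d)) (2 ^ t) (2 ^ l) => x y z w _ dt dV xy lz.
have lxy : l * (x * y) <= l * z + l * x by rewrite -mulnDr leq_mul2l xy orbT.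
have xld : x * l * d <= x * l * #|V| by rewrite leq_mul2l dV orbT.
have xlV : x * l <= x * l * #|V| by rewrite leq_pmulr.
nia.
Qed.

(** The bound for a block is proportional to its cardinality, and the cardinalities add up to
    [n]. *)
Lemma neciporuk_sum_le D b n (f : boolfun n) (P : {set {set 'I_n}}) l :
    is_neciporuk (LNBF D) b -> finset.partition P [set: 'I_n] ->
    0 < l -> n <= 2 ^ l ->
  2 ^ D * l * neciporuk_sum b f P <= n * (5 * 2 ^ l + 9 * (2 ^ D * l)).
Proof.
move=> bN partP l_gt0 n_le; rewrite big_distrr /=.
have sum_card : \sum_(V in P) #|V| = n.
  by rewrite -(card_partition partP) cardsT card_ord.
rewrite -[X in _ <= X * _]sum_card big_distrl /=; apply: leq_sum => V VP.
apply: neciporuk_block_le => //; rewrite card_gt0.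
by case/and3P: partP => _ _; apply: contraNneq => <-.
Qed.

Lemma best_neciporuk_LNBF_le D (F : forall n, boolfun n) n l :
    0 < l -> n <= 2 ^ l -> 2 ^ l <= 2 * n ->
  2 ^ D * l * best_neciporuk (LNBF D) F n <=
    10 * (n ^ 2 + 2 ^ D * l * n).
Proof.
move=> l_gt0 n_le le_2n; rewrite /best_neciporuk.
case: ex_maxnP => v /asboolP[b [P [bN partP <-]]] _.
apply: leq_trans; first exact: neciporuk_sum_le bN partP l_gt0 n_le.
have : n * 2 ^ l <= n * (2 * n) by rewrite leq_mul2l le_2n orbT.
by rewrite -mulnn; lia.
Qed.

(** Since [BF] is at most [LNBF 0], every Neciporuk function for [BF] is one for [LNBF 0]. *)
Lemma best_neciporuk_BF_le (F : forall n, boolfun n) n :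
  best_neciporuk BF F n <= best_neciporuk (LNBF 0) F n.
Proof.
rewrite [leqRHS]/best_neciporuk; case: ex_maxnP => v _; apply.
rewrite /best_neciporuk; case: ex_maxnP => w /asboolP[b [P [[b_mono bP] partP bE]]] _.
apply/asboolP; exists b, P; split=> //; split=> // m f Q partQ.
exact: leq_trans (bP _ _ _ partQ) (BF_le_LNBF0 f).
Qed.

(** * Passage to real numbers and asymptotics *)

Import numFieldNormedType.Exports.
Import Order.TTheory GRing.Theory Num.Theory.
Local Open Scope ring_scope.
Local Open Scope classical_set_scope.

Lemma log2_gt0 (R : realType) (n : nat) : (1 < n)%N -> 0 < log2 (n%:R : R).
Proof. by move=> n_gt1; rewrite divr_gt0 // ln_gt0 // ltr1n. Qed.

Lemma log2_le (R : realType) (n l : nat) :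
  (0 < n)%N -> (n <= 2 ^ l)%N -> log2 (n%:R : R) <= l%:R.
Proof.
move=> n_gt0 n_le; rewrite ler_pdivrMr ?ln_gt0 ?ltr1n //.
rewrite mulr_natl -lnXn // -natrX ler_ln ?ler_nat // posrE ltr0n //.
by rewrite expn_gt0.
Qed.

Lemma best_neciporuk_LNBF_max (R : realType) D (F : forall n, boolfun n) n :
    (1 < n)%N ->
  (best_neciporuk (LNBF D) F n)%:R <=
    20%:R * Num.max (n%:R ^+ 2 / (2 ^+ D * log2 n%:R)) n%:R :> R.
Proof.
move=> n_gt1; have n_gt0 : (0 < n)%N by apply: ltnW.
have l_gt0 : (0 < up_log 2 n)%N by rewrite up_log_gt0.
have n_le : (n <= 2 ^ up_log 2 n)%N by apply: up_logP.
have le_2n : (2 ^ up_log 2 n <= 2 * n)%N.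
  have /andP[/ltnW] := up_log_bounds (isT : (1 < 2)%N) n_gt1.
  by rewrite -(leq_pmul2l (isT : (0 < 2)%N)) -expnS prednK.
have := best_neciporuk_LNBF_le D F l_gt0 n_le le_2n.
have := log2_le R n_gt0 n_le; have := log2_gt0 R n_gt1.
move: (up_log 2 n) l_gt0 (log2 _) (best_neciporuk _ _ _) => l l_gt0 x B x_gt0 x_le.
rewrite -(ler_nat R) !(natrM, natrD, natrX).
set y := _ / _; set z := Num.max _ _ => B_le.
have y_le : y <= z by rewrite le_max lexx.
have n_le_z : n%:R <= z by rewrite le_max lexx orbT.
have D_gt0 : 0 < 2 ^+ D :> R by rewrite exprn_gt0.
have pos : 0 < 2 ^+ D * l%:R :> R by rewrite mulr_gt0 ?ltr0n.
have yE : n%:R ^+ 2 <= 2 ^+ D * l%:R * y.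
  rewrite mulrA ler_pdivlMr ?mulr_gt0 // mulrC ler_wpM2r ?sqr_ge0 //.
  by rewrite ler_wpM2l // ltW.
rewrite -(ler_pM2l pos); apply: le_trans B_le _.
(* Each of the two terms of [B_le] is at most [10 * (2 ^ D * l * z)], hence the constant 20. *)
have -> : 2 ^+ D * l%:R * (20%:R * z) = 10%:R * (2 ^+ D * l%:R * z + 2 ^+ D * l%:R * z).
  by ring.
rewrite ler_wpM2l // lerD //; last by rewrite ler_wpM2l // ltW.
by apply: le_trans yE _; rewrite ler_wpM2l // ltW.
Qed.

Theorem theorem8p4 (R : realType) (F : forall n : nat, boolfun n) :
  (forall Delta : nat -> nat,
     (fun n : nat => (best_neciporuk (LNBF (Delta n)) F n)%:R : R^o) =O_\oo
     (fun n : nat =>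
        Num.max (n%:R ^+ 2 / (2 ^+ Delta n * log2 n%:R)) n%:R : R^o)) /\
  (fun n : nat => (best_neciporuk BF F n)%:R : R^o) =O_\oo
  (fun n : nat => n%:R ^+ 2 / log2 n%:R : R^o).
Proof.
split=> [Delta|]; apply/eqO_exP; exists 20%:R => //; near=> n.
- have n_gt1 : (1 < n)%N by near: n; apply: nbhs_infty_gt.
  rewrite ger0_norm // (le_trans (best_neciporuk_LNBF_max R _ _ n_gt1)) //.
  by rewrite ler_wpM2l // ler_norm.
- have n_gt1 : (1 < n)%N by near: n; apply: nbhs_infty_gt.
  have n_gt0 : (0 < n)%N by apply: ltnW.
  have log_le : log2 n%:R <= n%:R :> R.
    by apply: log2_le => //; apply/ltnW/ltn_expl.
  rewrite ger0_norm //.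
  have /le_trans -> // : (best_neciporuk BF F n)%:R <= (best_neciporuk (LNBF 0) F n)%:R :> R.
    by rewrite ler_nat best_neciporuk_BF_le.
  rewrite (le_trans (best_neciporuk_LNBF_max R _ _ n_gt1)) // ler_wpM2l //.
  (* Without guesses the maximum is its first term, because [log2 n <= n]. *)
  rewrite expr0 mul1r max_l ?ler_norm //.
  by rewrite ler_pdivlMr ?log2_gt0 // expr2 ler_wpM2l.
Unshelve. all: by end_near.
Qed.
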